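(* Let $t>0$ be an integer. There is a constant $C_t$ such that the following holds. Let $M$ be an $n\times n$ $0$-$1$ matrix for which there do not exist $t$ rows $r_1,\dots,r_t$ and $t$ columns $c_1,\dots,c_t$ such that row $r_i$ and column $c_j$ cross for every $1\le i,j\le t$. Then $M$ has at most $C_t n$ entries equal to $1$.
   Context: In a $0$-$1$ matrix $M$, row $i$ and column $j$ cross if $M_{ij}=1$, or if there exist indices $i_1<i<i_2$ and $j_1<j<j_2$ with $M_{ij_1}=M_{ij_2}=M_{i_1j}=M_{i_2j}=1$. *)

(* Defs.v *)
From mathcomp Require Import all_boot all_algebra.
Set Implicit Arguments. Unset Strict Implicit. Unset Printing Implicit Defensive.

Definition cross (n : nat) (M : 'M[bool]_n) (i j : 'I_n) : Prop :=
  M i j \/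
  exists (i1 i2 j1 j2 : 'I_n),
    [/\ i1 < i < i2, j1 < j < j2 &
        [/\ M i j1, M i j2, M i1 j & M i2 j]].

Definition ones (n : nat) (M : 'M[bool]_n) : nat :=
  #|[set ij : 'I_n * 'I_n | M ij.1 ij.2]|.

(* Main.v *)
Require Import Defs.
From mathcomp Require Import all_boot all_algebra.
From mathcomp Require Import zify.

Set Implicit Arguments. Unset Strict Implicit. Unset Printing Implicit Defensive.

(** Row [i] and column [j] cross as soon as the horizontal segment spanned by the
    ones of row [i] meets the vertical segment spanned by the ones of column [j].
    Let [P] be the set of these intersection points, and let [rt] and [dn] move a
    point of [P] to the next one on its row and on its column.  All but [6 n]
    points [p] of [P] are the top left corner of a rectangular face of the
    arrangement of segments, so that [rt (dn p) = dn (rt p)]: any other face can be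
    charged to an endpoint of a segment.  Since [rt] and [dn] are injective where
    they are defined, all but [3 ^ k * 6 n] points of [P] meet only such corners
    during any [k] moves.  The points reached in [2 t] moves from one such point
    contain a [t * t] grid of crossings. *)

(** * Counting by injections *)

Lemma leq_card_rel (T U : finType) (A : {set T}) (R : T -> U -> bool) :
    (forall p, p \in A -> exists c, R p c) ->
    (forall p q c, p \in A -> q \in A -> R p c -> R q c -> p = q) ->
  #|A| <= #|U|.
Proof.
move=> exR injR.
have [->|[p0 p0A]] := set_0Vmem A; first by rewrite cards0.
have [c0 _] := exR _ p0A.
(* The default [c0] only makes [f] total; it is never taken on [A]. *)
pose f p := odflt c0 [pick c | R p c].
have fP p : p \in A -> R p (f p).
  by move=> /exR[c Rpc]; rewrite /f; case: pickP => [//|/(_ c)]; rewrite Rpc.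
rewrite -(card_in_imset (f := f)) ?max_card // => p q pA qA fpq.
by apply: (injR p q (f p)) => //; [exact: fP | rewrite fpq; exact: fP].
Qed.

Lemma leq_card_in (T : finType) (A B : {set T}) (f : T -> T) :
    {in A &, injective f} -> {in A, forall p, f p \in B} ->
  #|A| <= #|B|.
Proof.
move=> injf fB; rewrite -(card_in_imset injf); apply/subset_leq_card/subsetP.
by move=> _ /imsetP[p pA ->]; exact: fB.
Qed.

Lemma leq_cardsU_add (T : finType) (A B : {set T}) a b :
  #|A| <= a -> #|B| <= b -> #|A :|: B| <= a + b.
Proof. by move=> Aa Bb; rewrite (leq_trans (leq_card_setU _ _)) // leq_add. Qed.

(** * Successors within a set of indices *)

Section Next.
Variables (n : nat) (A : pred 'I_n).
Implicit Types j k : 'I_n.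

Definition has_next j := [exists k : 'I_n, (j < k) && A k].
Definition has_prev j := [exists k : 'I_n, (k < j) && A k].
(* [next j = j] when there is no element of [A] above [j]. *)
Definition next j : 'I_n :=
  odflt j [pick k : 'I_n | [&& j < k, A k &
    [forall k' : 'I_n, (j < k') && A k' ==> (k <= k')]]].

Lemma nextP j : has_next j ->
  [/\ j < next j, A (next j) & forall k, j < k -> A k -> next j <= k].
Proof.
case/existsP=> k0 Pk0; rewrite /next; case: pickP => [k|/=].
  case/and3P=> jk Ak /forallP kmin; split=> // k' jk' Ak'.
  by have /implyP := kmin k'; rewrite jk' Ak'; apply.
have [k Pk kmin] := @arg_minnP _ k0 (fun k => (j < k) && A k) val Pk0.
move/(_ k); case/andP: (Pk) => -> -> /= /negbT/negP[].
by apply/forallP=> k'; apply/implyP => /kmin.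
Qed.

(** If [j < k], minimality gives [next j <= k < next k]; the other order is symmetric. *)
Lemma next_inj j k : A j -> A k -> has_next j -> has_next k ->
  next j = next k -> j = k.
Proof.
move=> Aj Ak /nextP[jn _ jmin] /nextP[kn _ kmin] e.
apply/val_inj; case: (ltngtP j k) => // [jk|kj].
  by have := jmin _ jk Ak; rewrite e; lia.
by have := kmin _ kj Aj; rewrite -e; lia.
Qed.

Lemma has_nextPn j k : ~~ has_next j -> A k -> k <= j.
Proof.
by move=> /existsPn/(_ k); rewrite negb_and -leqNgt => /orP[//|/negP].
Qed.

Lemma has_prevPn j k : ~~ has_prev j -> A k -> j <= k.
Proof.
by move=> /existsPn/(_ k); rewrite negb_and -leqNgt => /orP[//|/negP].
Qed.

End Next.

(** * Intersection points of the segments and moves between them *)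

Section Arrangement.
Variables (n : nat) (hs vs : rel 'I_n).
Hypothesis hs_convex : forall i j k l : 'I_n,
  j <= k <= l -> hs i j -> hs i l -> hs i k.
Hypothesis vs_convex : forall i j k l : 'I_n,
  j <= k <= l -> vs j i -> vs l i -> vs k i.

Local Notation point := ('I_n * 'I_n)%type.
Implicit Types p q : point.

Let inP i j := hs i j && vs i j.
Definition crossings : {set point} := [set p | inP p.1 p.2].
Local Notation P := crossings.

Let hasR p := has_next (inP p.1) p.2.
Let hasL p := has_prev (inP p.1) p.2.
Let hasD p := has_next (inP^~ p.2) p.1.
Definition rt p : point := (p.1, next (inP p.1) p.2).
Definition dn p : point := (next (inP^~ p.2) p.1, p.2).

(** A move without a target stays put, so the equation also forces [dn p] to have a right neighbour
    and [rt p] a lower one. *)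
Definition corners : {set point} :=
  [set p in P | [&& hasR p, hasD p & rt (dn p) == dn (rt p)]].

Lemma corner_crossing p : p \in corners -> p \in P.
Proof. by rewrite inE => /andP[]. Qed.

Lemma corner_comm p : p \in corners -> rt (dn p) = dn (rt p).
Proof. by rewrite inE => /and4P[_ _ _ /eqP]. Qed.

Lemma rt_crossing p : hasR p -> rt p \in P.
Proof. by move=> /nextP[_ Ap _]; rewrite inE. Qed.

Lemma dn_crossing p : hasD p -> dn p \in P.
Proof. by move=> /nextP[_ Ap _]; rewrite inE. Qed.

Lemma rt_inj p q : p \in P -> q \in P -> hasR p -> hasR q -> rt p = rt q -> p = q.
Proof.
rewrite !inE /hasR; case: p q => [i j] [k l] /= Pp Pq Rp Rq [] e.
by case: k / e Pq Rq => Pq Rq /next_inj -> //.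
Qed.

Lemma dn_inj p q : p \in P -> q \in P -> hasD p -> hasD q -> dn p = dn q -> p = q.
Proof.
rewrite !inE /hasD; case: p q => [i j] [k l] /= Pp Pq Rp Rq [] + e.
by case: l / e Pq Rq => Pq Rq /next_inj -> //.
Qed.

(** * Counting the points that are not corners *)

Lemma card_row_last : #|[set p in P | ~~ hasR p]| <= n.
Proof.
rewrite -[leqRHS]card_ord.
apply: (@leq_card_rel _ _ _ (fun p i => p.1 == i)) => [p _|]; first by exists p.1.
move=> [i j] [k l] c; rewrite !inE /hasR /= => /andP[Pp Rp] /andP[Pq Rq].
move=> /eqP e1 /eqP e2; subst i k; congr pair; apply/val_inj/eqP.
by rewrite eqn_leq (has_nextPn Rq Pp) (has_nextPn Rp Pq).
Qed.

Lemma card_row_first : #|[set p in P | ~~ hasL p]| <= n.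
Proof.
rewrite -[leqRHS]card_ord.
apply: (@leq_card_rel _ _ _ (fun p i => p.1 == i)) => [p _|]; first by exists p.1.
move=> [i j] [k l] c; rewrite !inE /hasL /= => /andP[Pp Rp] /andP[Pq Rq].
move=> /eqP e1 /eqP e2; subst i k; congr pair; apply/val_inj/eqP.
by rewrite eqn_leq (has_prevPn Rq Pp) (has_prevPn Rp Pq).
Qed.

Lemma card_col_last : #|[set p in P | ~~ hasD p]| <= n.
Proof.
rewrite -[leqRHS]card_ord.
apply: (@leq_card_rel _ _ _ (fun p i => p.2 == i)) => [p _|]; first by exists p.2.
move=> [i j] [k l] c; rewrite !inE /hasD /= => /andP[Pp Rp] /andP[Pq Rq].
move=> /eqP e1 /eqP e2; subst j l; congr pair; apply/val_inj/eqP.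
by rewrite eqn_leq (has_nextPn Rq Pp) (has_nextPn Rp Pq).
Qed.

(** Here and in the next two bounds the fault sits at a point reached from [p]; the moves are
    injective, so the bounds on extreme points carry over. *)
Lemma card_dn_row_last : #|[set p in P | hasD p && ~~ hasR (dn p)]| <= n.
Proof.
apply: leq_trans card_row_last; apply: (leq_card_in (f := dn)) => [p q|p].
  by rewrite !inE => /and3P[? ? _] /and3P[? ? _]; apply: dn_inj; rewrite ?inE.
by rewrite !inE => /and3P[_ /dn_crossing]; rewrite inE => -> ->.
Qed.

Lemma card_rt_col_last : #|[set p in P | hasR p && ~~ hasD (rt p)]| <= n.
Proof.
apply: leq_trans card_col_last; apply: (leq_card_in (f := rt)) => [p q|p].
  by rewrite !inE => /and3P[? ? _] /and3P[? ? _]; apply: rt_inj; rewrite ?inE.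
by rewrite !inE => /and3P[_ /rt_crossing]; rewrite inE => -> ->.
Qed.

Lemma card_dn_rt_row_first :
  #|[set p in P | [&& hasR p, hasD (rt p) & ~~ hasL (dn (rt p))]]| <= n.
Proof.
apply: leq_trans card_row_first.
apply: (leq_card_in (f := fun p => dn (rt p))) => [p q|p]; last first.
  by rewrite !inE => /and4P[_ _ /dn_crossing]; rewrite inE => -> ->.
rewrite !inE => /and4P[? Rp Dp _] /and4P[? Rq Dq _] /dn_inj e.
by apply: rt_inj; rewrite ?inE // e ?rt_crossing.
Qed.

(* Column [c] starts at row [s], inside the face with top left corner [p], and no
   column to the left of [c] meets that face above row [s]. *)
Let starts_in_face p (c : 'I_n) := [exists s : 'I_n,
  [&& p.2 < c, p.1 < s, vs s c & vs s p.2] &&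
  [forall s' : 'I_n, (s' < s) ==> [&& ~~ vs s' c,
     (p.1 < s') ==> ~~ inP s' p.2 &
     (p.1 <= s') ==> [forall d : 'I_n, (p.2 < d < c) ==> ~~ vs s' d]]]].

(** The row [s] is determined by [c], as its top row. If one corner's column lay strictly between
    the other's and [c], it would reach down to [s] and cut the other face. So the corners share a
    column, and neither can lie between the other and row [s]. *)
Lemma starts_in_face_inj p q c :
  p \in P -> q \in P -> starts_in_face p c -> starts_in_face q c -> p = q.
Proof.
case: p q => [i j] [k l]; rewrite !inE /= => Pp Pq.
move=> /existsP[s /= /andP[/and4P[jc isl sc sj] /forallP ps]].
move=> /existsP[s2 /= /andP[/and4P[lc ks sc2 sl] /forallP qs]].
have e : s2 = s.
  apply/val_inj; case: (ltngtP s2 s) => // lt.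
    by move: (ps s2); rewrite lt sc2.
  by move: (qs s); rewrite lt sc.
subst s2.
have key (i1 j1 k1 l1 : 'I_n) : inP k1 l1 -> i1 < s -> k1 < s -> l1 < c -> vs s l1 ->
   (forall s' : 'I_n, (s' < s) ==> [&& ~~ vs s' c,
     (i1 < s') ==> ~~ inP s' j1 &
     (i1 <= s') ==> [forall d : 'I_n, (j1 < d < c) ==> ~~ vs s' d]]) ->
   l1 <= j1.
  move=> /andP[_ vkl] i1s k1s l1c vsl1 H; rewrite leqNgt; apply/negP=> jl.
  (* The lower of the two top rows: column [l1] runs from [k1] to [s], so it occupies row [m], where
     [H] forbids it. *)
  pose m := if i1 <= k1 then k1 else i1.
  have ms : [&& m < s, i1 <= m & k1 <= m] by rewrite /m; case: ifP; lia.
  case/and3P: ms => ms im km.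
  have := H m; rewrite ms im /= => /and3P[_ _ /forallP/(_ l1)].
  rewrite jl l1c /= (vs_convex _ vkl vsl1) //; lia.
have ejl : j = l.
  apply/val_inj/eqP; rewrite eqn_leq (key _ _ _ _ Pp ks isl) //.
  by rewrite (key _ _ _ _ Pq isl ks).
subst l; congr pair; apply/val_inj; case: (ltngtP i k) => // lt.
  by move: (ps k); rewrite ks lt Pq /= andbF.
by move: (qs i); rewrite isl lt Pp /= andbF.
Qed.

(** If no column strictly between the left and right sides met the face below its top row, the face
    would close up as a rectangle. The column that does so highest up must start there. *)
Lemma starts_in_face_ex p : p \in P -> hasR p -> hasD p -> hasR (dn p) ->
  hasD (rt p) -> hasL (dn (rt p)) -> rt (dn p) <> dn (rt p) ->
  exists c, starts_in_face p c.
Proof.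
case: p => [i j]; rewrite inE /hasR /hasD /hasL /rt /dn /=.
set j' := next (inP i) j; set i' := next _ i.
move=> Pp /nextP[jj' Pj' minj] /nextP[ii' Pi' mini] /nextP[].
rewrite -/i' -/j' in Pj' minj Pi' mini jj' ii' *.
set k := next _ j; set i'' := next _ i.
move=> jk Pk mink /nextP[]; rewrite -/i'' => ii'' Pi'' mini'' hasl neq.
have /andP[hij vij] := Pp; have /andP[hij' vij'] := Pj'.
have /andP[hi'j vi'j] := Pi'; have /andP[hi''j' vi''j'] := Pi''.
(* Pairs here are a column followed by a row, the reverse of points. *)
pose cand (x : 'I_n * 'I_n) :=
  [&& j < x.1 < j', i < x.2 <= i', x.2 <= i'' & vs x.2 x.1].
have [x0 candx0] : exists x, cand x.
  case: (leqP i' i'') => le.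
    case: (ltnP k j') => kj'.
      by exists (k, i'); case/andP: Pk => _ vk; rewrite /cand /= jk kj' ii' leqnn le.
    case: neq.
    (* Row [i'] and column [j'] both extend to [(i', j')], so both paths would end there. *)
    have h1 : hs i' j'.
      by apply: (@hs_convex i' j j' k); [rewrite (ltnW jj') | | case/andP: Pk].
    have v1 : vs i' j' by apply: (@vs_convex j' i i' i'') => //; rewrite (ltnW ii').
    have P1 : inP i' j' by rewrite /inP h1.
    congr pair; apply/val_inj/eqP; rewrite eqn_leq.
      by rewrite le (mini'' _ ii' P1).
    by rewrite kj' (mink _ jj' P1).
  case/existsP: hasl => l /andP[lj' Pl].
  case: (ltnP j l) => jl.
    exists (l, i''); case/andP: Pl => _ vl.
    by rewrite /cand /= jl lj' ii'' (ltnW le) leqnn.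
  (* Row [i''] would meet column [j] above [i'], against the choice of [i']. *)
  have h1 : hs i'' j.
    by apply: (@hs_convex i'' l j j'); [rewrite jl (ltnW jj') | case/andP: Pl |].
  have v1 : vs i'' j.
    by apply: (@vs_convex j i i'' i') => //; rewrite (ltnW ii'') (ltnW le).
  have P1 : inP i'' j by rewrite /inP h1.
  by have := mini _ ii'' P1; rewrite leqNgt le.
have [[c s] candx xmin] := arg_minnP (fun x : 'I_n * 'I_n => x.2 : nat) candx0.
case/and4P: candx => /= /andP[jc cj'] /andP[is_ si'] si'' vsc.
have novs (d : 'I_n) : j < d -> d < j' -> ~~ vs i d.
  move=> jd dj'; apply/negP=> vid.
  have h1 : hs i d by apply: (@hs_convex i j d j') => //; rewrite (ltnW jd) ltnW.
  have P1 : inP i d by rewrite /inP h1.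
  by have := minj _ jd P1; rewrite leqNgt dj'.
have novs2 (d s' : 'I_n) : j < d -> d < j' -> i <= s' -> s' < s -> ~~ vs s' d.
  move=> jd dj' is' s's; apply/negP => vs'd.
  move: is'; rewrite leq_eqVlt => /predU1P[/val_inj e|is'].
    by move: (novs _ jd dj'); rewrite e vs'd.
  have := xmin (d, s'); rewrite /cand /= jd dj' is' vs'd.
  rewrite (leq_trans (ltnW s's) si') (leq_trans (ltnW s's) si'') => /(_ isT).
  by rewrite leqNgt s's.
exists c; apply/existsP; exists s; apply/andP; split=> /=.
  by rewrite jc is_ vsc (vs_convex _ vij vi'j) // (ltnW is_).
apply/forallP=> s'; apply/implyP => s's; apply/and3P; split.
(* A column [c] present above row [i] would cross row [i] by convexity, giving a point between [p]
   and [rt p]. *)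
- case: (leqP i s') => is'; first exact: novs2.
  apply/negP=> v1; move/negP: (novs _ jc cj'); apply.
  by apply: (vs_convex _ v1 vsc); rewrite (ltnW is') ltnW.
- apply/implyP=> is'; apply/negP=> P1.
  by have := mini _ is' P1; rewrite leqNgt (leq_trans s's si').
- apply/implyP=> is'; apply/forallP=> d; apply/implyP=> /andP[jd dc].
  by apply: novs2 => //; exact: ltn_trans cj'.
Qed.

(** Five classes lack a neighbouring point somewhere around the face. In the sixth, [A], all exist
    but the two paths disagree, and the face is charged to a column starting in it. *)
Lemma card_not_corner : #|P :\: corners| <= 6 * n.
Proof.
pose A := [set p in P | [&& hasR p, hasD p, hasR (dn p),
  hasD (rt p), hasL (dn (rt p)) & rt (dn p) != dn (rt p)]].
have cardA : #|A| <= n.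
  rewrite -[leqRHS]card_ord.
  apply: (@leq_card_rel _ _ _ starts_in_face) => [p|p q c].
    rewrite inE => /andP[Pp /and5P[? ? ? ? /andP[? /eqP ?]]].
    exact: starts_in_face_ex.
  rewrite !(inE, in_setI) => /andP[Pp _] /andP[Pq _].
  by apply: starts_in_face_inj; rewrite inE.
have sub : P :\: corners \subset
    [set p in P | ~~ hasR p] :|: [set p in P | ~~ hasD p]
    :|: [set p in P | hasD p && ~~ hasR (dn p)]
    :|: [set p in P | hasR p && ~~ hasD (rt p)]
    :|: [set p in P | [&& hasR p, hasD (rt p) & ~~ hasL (dn (rt p))]] :|: A.
  apply/subsetP=> p; rewrite !inE; case: (inP _ _) => //=; rewrite ?andbF //.
  by case: (hasR p) (hasD p) (hasR (dn p)) (hasD (rt p)) (hasL (dn (rt p)))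
    (_ == _) => [] [] [] [] [] [].
apply: leq_trans (subset_leq_card sub) _.
have -> : 6 * n = n + n + n + n + n + n by lia.
apply: leq_cardsU_add cardA; apply: leq_cardsU_add card_dn_rt_row_first; apply: leq_cardsU_add card_rt_col_last.
by apply: leq_cardsU_add card_dn_row_last; apply: leq_cardsU_add card_row_last card_col_last.
Qed.

(** * Points that meet only corners for several moves *)

Definition step (X : {set point}) : {set point} :=
  X :|: [set p in corners | rt p \in X] :|: [set p in corners | dn p \in X].

Lemma card_step X : #|step X| <= 3 * #|X|.
Proof.
have cR : #|[set p in corners | rt p \in X]| <= #|X|.
  apply: (leq_card_in (f := rt)) => [p q|p]; last by rewrite inE => /andP[].
  rewrite !inE => /andP[/and4P[? ? _ _] _] /andP[/and4P[? ? _ _] _].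
  by apply: rt_inj; rewrite ?inE.
have cD : #|[set p in corners | dn p \in X]| <= #|X|.
  apply: (leq_card_in (f := dn)) => [p q|p]; last by rewrite inE => /andP[].
  rewrite !inE => /andP[/and4P[? _ ? _] _] /andP[/and4P[? _ ? _] _].
  by apply: dn_inj; rewrite ?inE.
rewrite (_ : 3 * #|X| = #|X| + #|X| + #|X|); last by lia.
by apply: leq_cardsU_add cD; apply: leq_cardsU_add cR.
Qed.

(** The points that at most [k] moves, each made at a corner, can bring to a non-corner. *)
Definition defective k := iter k step (P :\: corners).

Lemma card_defective k : #|defective k| <= 3 ^ k * (6 * n).
Proof.
elim: k => [|k IHk]; first by rewrite mul1n card_not_corner.
apply: leq_trans (card_step _) _.
by rewrite expnS -mulnA leq_mul2l IHk.
Qed.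

Definition regular k : {set point} := P :\: defective k.

Lemma regular_corner k p : p \in regular k -> p \in corners.
Proof.
rewrite in_setD => /andP[pk Pp]; apply: contraNT pk => pc.
elim: k => [|k IHk]; first by rewrite in_setD pc.
by rewrite /defective iterS /step !in_setU IHk.
Qed.

Lemma regularS k p : p \in regular k.+1 ->
  [/\ p \in regular k, rt p \in regular k & dn p \in regular k].
Proof.
move=> rp; have pc := regular_corner rp; move: rp.
rewrite in_setD /defective iterS -/(defective k) !in_setU !negb_or.
have := pc; rewrite inE => /and4P[_ Rp Dp _].
case/andP=> /andP[/andP[pk rk] dk] Pp; rewrite /regular !in_setD pk Pp.
rewrite rt_crossing // dn_crossing // !andbT; split=> //.
  by apply: contraNN rk => rk; apply/setIdP.
by apply: contraNN dk => dk; apply/setIdP.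
Qed.

Lemma regularW k a p : p \in regular (a + k) -> p \in regular k.
Proof. by elim: a => [//|a IHa]; rewrite addSn => /regularS[/IHa]. Qed.

Lemma regular_rt k a p : p \in regular (a + k) -> iter a rt p \in regular k.
Proof.
elim: a p => [//|a IHa] p; rewrite addSn iterSr => /regularS[_ ? _].
exact: IHa.
Qed.

Lemma regular_dn k a p : p \in regular (a + k) -> iter a dn p \in regular k.
Proof.
elim: a p => [//|a IHa] p; rewrite addSn iterSr => /regularS[_ _ ?].
exact: IHa.
Qed.

(** * Commuting moves and the grid *)

(** Every point passed is a corner, so [dn] slides past [rt] one face at a time. *)
Lemma dn_iter_rt b p : p \in regular b -> dn (iter b rt p) = iter b rt (dn p).
Proof.
elim: b p => [//|b IHb] p pb; have [_ rb _] := regularS pb.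
by rewrite !iterSr IHb // (corner_comm (regular_corner pb)).
Qed.

Lemma iter_dn_rt a b p : p \in regular (a + b) ->
  iter a dn (iter b rt p) = iter b rt (iter a dn p).
Proof.
elim: a p => [//|a IHa] p pab; rewrite iterSr dn_iter_rt; last first.
  exact: regularW pab.
by rewrite addSn in pab; have [_ _ ?] := regularS pab; rewrite IHa // iterSr.
Qed.

Lemma iter_dn_lt k p a b : p \in regular k -> a < b <= k ->
  (iter a dn p).1 < (iter b dn p).1.
Proof.
move=> pk; elim: b => [//|b IHb] /andP[ab bk].
have lt : (iter b dn p).1 < (iter b.+1 dn p).1.
  have /regular_dn/regular_corner : p \in regular (b + (k - b)).
    by rewrite subnKC // ltnW.
  by rewrite inE => /and4P[_ _ /nextP[]].
move: ab; rewrite ltnS leq_eqVlt => /predU1P[-> //|ab].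
by apply: ltn_trans lt; apply: IHb; rewrite ab ltnW.
Qed.

Lemma iter_rt_lt k p a b : p \in regular k -> a < b <= k ->
  (iter a rt p).2 < (iter b rt p).2.
Proof.
move=> pk; elim: b => [//|b IHb] /andP[ab bk].
have lt : (iter b rt p).2 < (iter b.+1 rt p).2.
  have /regular_rt/regular_corner : p \in regular (b + (k - b)).
    by rewrite subnKC // ltnW.
  by rewrite inE => /and4P[_ /nextP[]].
move: ab; rewrite ltnS leq_eqVlt => /predU1P[-> //|ab].
by apply: ltn_trans lt; apply: IHb; rewrite ab ltnW.
Qed.

(** Rows come from moving down from [p], columns from moving right. As the moves commute, [a] moves
    down and [b] moves right lead to the intersection of row [r a] and column [c b]. *)
Lemma grid_of_regular t p : p \in regular (t + t) ->
  exists r c : 'I_t -> 'I_n, [/\ injective r, injective c &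
    forall a b, (r a, c b) \in P].
Proof.
move=> pt.
exists (fun a => (iter a dn p).1), (fun b => (iter b rt p).2); split.
- move=> a b e; apply/val_inj; case: (ltngtP a b) => // lt.
    have ab : a < b <= t + t by have := ltn_ord b; lia.
    by have := iter_dn_lt pt ab; rewrite e ltnn.
  have ba : b < a <= t + t by have := ltn_ord a; lia.
  by have := iter_dn_lt pt ba; rewrite e ltnn.
- move=> a b e; apply/val_inj; case: (ltngtP a b) => // lt.
    have ab : a < b <= t + t by have := ltn_ord b; lia.
    by have := iter_rt_lt pt ab; rewrite e ltnn.
  have ba : b < a <= t + t by have := ltn_ord a; lia.
  by have := iter_rt_lt pt ba; rewrite e ltnn.
move=> a b.
have pab : p \in regular (b + a).
  apply: (@regularW _ (t + t - (b + a))); rewrite subnK //.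
  by have := ltn_ord a; have := ltn_ord b; lia.
have rt1 d q : (iter d rt q).1 = q.1 by elim: d => //= d ->.
have dn2 d q : (iter d dn q).2 = q.2 by elim: d => //= d ->.
have -> : ((iter a dn p).1, (iter b rt p).2) = iter b rt (iter a dn p).
  rewrite [RHS]surjective_pairing rt1 -iter_dn_rt ?dn2 //.
  by rewrite addnC.
rewrite -iter_dn_rt 1?addnC //; apply: corner_crossing.
apply: (@regular_corner 0); apply: regular_dn; rewrite addn0.
exact: regular_rt.
Qed.

Lemma grid_of_many_crossings t : 3 ^ (t + t) * (6 * n) < #|P| ->
  exists r c : 'I_t -> 'I_n, [/\ injective r, injective c &
    forall a b, (r a, c b) \in P].
Proof.
move=> big; have [e|[p]] := set_0Vmem (regular (t + t)); last first.
  exact: grid_of_regular.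
move/eqP: e; rewrite setD_eq0 => /subset_leq_card.
by rewrite leqNgt (leq_ltn_trans (card_defective _) big).
Qed.

End Arrangement.

(** * Segments spanned by the ones of a matrix *)

Section Spans.
Variables (n : nat) (M : 'M[bool]_n).

Definition row_span (i j : 'I_n) :=
  [exists k : 'I_n, (k <= j) && M i k] && [exists k : 'I_n, (j <= k) && M i k].
Definition col_span (i j : 'I_n) :=
  [exists k : 'I_n, (k <= i) && M k j] && [exists k : 'I_n, (i <= k) && M k j].

Lemma row_span_convex (i j k l : 'I_n) :
  j <= k <= l -> row_span i j -> row_span i l -> row_span i k.
Proof.
move=> /andP[jk kl] /andP[/existsP[x /andP[xj Mx]] _].
move=> /andP[_ /existsP[y /andP[ly My]]].
apply/andP; split; apply/existsP; [exists x | exists y].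
  by rewrite Mx (leq_trans xj).
by rewrite My (leq_trans kl).
Qed.

Lemma col_span_convex (i j k l : 'I_n) :
  j <= k <= l -> col_span j i -> col_span l i -> col_span k i.
Proof.
move=> /andP[jk kl] /andP[/existsP[x /andP[xj Mx]] _].
move=> /andP[_ /existsP[y /andP[ly My]]].
apply/andP; split; apply/existsP; [exists x | exists y].
  by rewrite Mx (leq_trans xj).
by rewrite My (leq_trans kl).
Qed.

(** When [M i j] is false, the ones witnessing the spans differ from [(i, j)], so the weak
    inequalities become strict. *)
Lemma crossings_cross i j : (i, j) \in crossings row_span col_span -> cross M i j.
Proof.
rewrite inE /= => /andP[] /andP[/existsP[j1 /andP[j1j M1]] /existsP[j2 /andP[jj2 M2]]].
move=> /andP[/existsP[i1 /andP[i1i M3]] /existsP[i2 /andP[ii2 M4]]].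
have [Mij|nMij] := boolP (M i j); [by left | right].
have neq (k : 'I_n) : M i k -> (k : nat) != j.
  by move=> Mk; apply: contraNneq nMij => /val_inj <-.
have neq' (k : 'I_n) : M k j -> (k : nat) != i.
  by move=> Mk; apply: contraNneq nMij => /val_inj <-.
exists i1, i2, j1, j2; split=> //.
  by rewrite !ltn_neqAle i1i ii2 neq' // eq_sym neq'.
by rewrite !ltn_neqAle j1j jj2 neq // eq_sym neq.
Qed.

Lemma ones_le_crossings : ones M <= #|crossings row_span col_span|.
Proof.
apply/subset_leq_card/subsetP => -[i j]; rewrite !inE /= => Mij.
by apply/andP; split; apply/andP; split; apply/existsP;
  [exists j | exists j | exists i | exists i]; rewrite leqnn.
Qed.

End Spans.

Theorem theorem3p1 (t : nat) (ht : 0 < t) :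
  exists C : nat, forall (n : nat) (M : 'M[bool]_n),
    ~ (exists (r c : 'I_t -> 'I_n), injective r /\ injective c /\
         forall i j : 'I_t, cross M (r i) (c j)) ->
    ones M <= C * n.
Proof.
(* The factor 6 counts the classes of non-corners; each of the [t + t] moves at most triples the
   defective set. *)
exists (3 ^ (t + t) * 6) => n M nogrid; rewrite leqNgt -mulnA; apply/negP => big.
apply: nogrid; have := leq_trans big (ones_le_crossings M).
move/(grid_of_many_crossings (@row_span_convex n M) (@col_span_convex n M)).
case=> r [c [injr injc rc]]; exists r, c; split=> //; split=> // i j.
exact: crossings_cross.
Qed.
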